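(* For every positive integer $k$, the dichromatic number of the tournament $\vec{T}_k$ is exactly equal to $k$.
   Context: The dichromatic number of a digraph is the minimum number of colors needed to color its vertices so that there is no monochromatic directed cycle. For a positive integer $k$, the tournament $\vec{T}_k$ is defined as follows. Its vertices are the $(2k-1)^2$ pairs (cells) $(i,j)$ of integers with $1\leq i,j\leq 2k-1$. The vertices are totally ordered by: $(i_1,j_1)<(i_2,j_2)$ iff either $i_1<i_2$, or $i_1=i_2$ and $j_1<j_2$. For two distinct vertices $(i_1,j_1),(i_2,j_2)$: if $j_1=j_2$, the edge between them is directed from $(i_1,j_1)$ to $(i_2,j_2)$ iff $(i_1,j_1)<(i_2,j_2)$; if $j_1\neq j_2$, the edge between them is directed from $(i_1,j_1)$ to $(i_2,j_2)$ iff $(i_1,j_1)>(i_2,j_2)$. (The subscript $k$ does not denote the number of vertices.) *)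

(* Defs.v *)
From mathcomp Require Import all_boot.

Set Implicit Arguments.
Unset Strict Implicit.
Unset Printing Implicit Defensive.

(* A finite digraph is given by its edge relation [e : rel V]. *)

Definition directed_cycle (V : finType) (e : rel V) (s : seq V) : Prop :=
  s != [::] /\ ucycle e s.

Definition monochromatic (V : finType) (n : nat) (c : V -> 'I_n) (s : seq V) :
  bool := constant [seq c x | x <- s].

Definition dicolorable (V : finType) (e : rel V) (n : nat) : Prop :=
  exists c : V -> 'I_n, forall s : seq V,
    directed_cycle e s -> ~~ monochromatic c s.

(* A relation rather than a function, since a digraph with a loop has no
   admissible colouring at all. *)
Definition is_dichromatic_number (V : finType) (e : rel V) (n : nat) : Prop :=
  dicolorable e n /\ (forall m : nat, dicolorable e m -> n <= m).

Definition is_tournament (V : finType) (e : rel V) : Prop :=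
  irreflexive e /\ (forall x y : V, x != y -> e x y (+) e y x).

(* Coordinates are numbered from 0 to 2k-2 instead of 1 to 2k-1. *)
Definition cell (k : nat) : finType := ('I_(k.*2.-1) * 'I_(k.*2.-1))%type.

Definition cell_lt (k : nat) (u v : cell k) : bool :=
  (u.1 < v.1) || ((u.1 == v.1) && (u.2 < v.2)).

Definition Tvec (k : nat) : rel (cell k) := fun u v =>
  (u != v) && (if u.2 == v.2 then cell_lt u v else cell_lt v u).

Lemma Tvec_tournament (k : nat) : is_tournament (@Tvec k).
Proof.
split=> [x|[a b] [c d] neq]; first by rewrite /Tvec eqxx.
rewrite /Tvec /cell_lt [_ == (a, b)]eq_sym neq /= [d == b]eq_sym [c == a]eq_sym.
move: neq; rewrite xpair_eqE -!val_eqE /=.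
by case: (ltngtP a c) => //=; case: (ltngtP b d).
Qed.

(* Main.v *)
Require Import Defs.
From mathcomp Require Import all_boot.
From mathcomp Require Import zify.

Set Implicit Arguments.
Unset Strict Implicit.
Unset Printing Implicit Defensive.

(** In [Tvec k], a set of cells induces an acyclic subtournament exactly when
    it contains no [u < v < w] with [u] and [w] in one column and [v] in
    another: such a triple spans a directed triangle, and it is the only kind
    of directed triangle, while a tournament without directed triangles is
    transitive.  Put n = 2k - 1.

    Lower bound.  Call a cell of such a set S late if S has a cell above it in
    the same column.  S has at most one cell per column that is not late.  It
    also has at most one late cell per row: if (i, j) and (i, j') are late with
    j < j', then a cell of S above (i, j') together with (i, j) and (i, j')
    forms a forbidden triple.  Hence |S| <= 2n, and m colours can cover the
    n^2 cells only if n <= 2m, that is, k <= m ([card_cell_color_class]).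

    Upper bound.  Give the cell (i, j) the colour floor(d / 2), where d is the
    residue of j - i modulo 2k.  The modulus is n + 1, so the grid should be
    thought of as lacking a row and a column of a 2k by 2k torus.  In a
    fixed column a colour class then has at most two cells, in adjacent rows
    i and i + 1, and a cell between them in the order would have to be the
    cyclic left neighbour of (i, j) or the cyclic right neighbour of
    (i + 1, j), lying on the wrong side of it because of a wrap-around; both
    neighbours would be in the missing column
    ([diagonal_color_no_interleaving]). *)

(** * Acyclic sets of cells *)

(** Acyclicity of all colour classes at once, as the absence of the one kind of
    directed triangle that [Tvec] can have. *)
Definition no_interleaving (k : nat) (T : eqType) (c : cell k -> T) : Prop :=
  forall u v w : cell k, c u = c v -> c v = c w -> u.2 = w.2 :> nat ->
    cell_lt u v -> cell_lt v w -> v.2 = u.2 :> nat.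

(** A closed walk along a transitive relation yields a loop. *)
Lemma transitive_cycle_loop (T : Type) (e : rel T) (x : T) (p : seq T) :
  transitive e -> cycle e (x :: p) -> e x x.
Proof.
by move=> e_tr /(order_path_min e_tr); rewrite all_rcons => /andP[].
Qed.

Lemma cell_eqE k (u v : cell k) :
  (u == v) = (u.1 == v.1 :> nat) && (u.2 == v.2 :> nat).
Proof. by case: u v => [a b] [a' b']; rewrite xpair_eqE -!val_eqE. Qed.

(** A failure of transitivity in a tournament is a directed triangle. *)
Lemma no_interleaving_trans k (T : eqType) (c : cell k -> T) (u v w : cell k) :
  no_interleaving c -> c u = c v -> c v = c w ->
  Tvec u v -> Tvec v w -> Tvec u w.
Proof.
move=> ok cuv cvw; have cwu := esym (etrans cuv cvw).
(* If u, v, w were a directed triangle, then u, w, v would be increasing up to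
   rotation, its two extremes lying in the same column. *)
have := ok u w v (esym cwu) (esym cvw).
have := ok v u w (esym cuv) (esym cwu).
have := ok w v u (esym cvw) (esym cuv).
rewrite /Tvec /cell_lt !cell_eqE -!val_eqE /=.
case: u v w {cuv cvw cwu} => [[a ha] [b hb]] [[a' ha'] [b' hb']].
case=> [[a'' ha''] [b'' hb'']] /=.
by do 3!case: ifP => ?; lia.
Qed.

Lemma no_interleaving_dicoloring k m (c : cell k -> 'I_m) :
  no_interleaving c ->
  forall s, directed_cycle (@Tvec k) s -> ~~ monochromatic c s.
Proof.
move=> ok [|x p] [//= _ /andP[cyc _]]; apply/negP => /= mono.
pose e := [rel u v | [&& Tvec u v, c u == c x & c v == c x]].
have e_tr : transitive e.
  move=> v u w /= /and3P[uv /eqP cu /eqP cv] /and3P[vw _ /eqP cw].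
  rewrite cu cw eqxx !andbT.
  by apply: (no_interleaving_trans ok) uv vw; rewrite ?cu ?cv ?cw.
suff /(transitive_cycle_loop e_tr) : cycle e (x :: p).
  by rewrite /= /Tvec eqxx.
have inx : all [pred u | c u == c x] (x :: p).
  by move: mono; rewrite /monochromatic /= all_map eqxx.
apply: (sub_in_cycle _ inx cyc) => u v /[!inE] cu cv /= uv.
by rewrite uv cu cv.
Qed.

Lemma dicoloring_no_interleaving k m (c : cell k -> 'I_m) :
  (forall s, directed_cycle (@Tvec k) s -> ~~ monochromatic c s) ->
  no_interleaving c.
Proof.
move=> ok u v w cuv cvw uw ltuv ltvw; apply/eqP/negPn/negP => vu.
suff /ok/negP[] : directed_cycle (@Tvec k) [:: u; w; v].
  by rewrite /monochromatic /= -cvw cuv eqxx.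
split=> //; move: uw vu ltuv ltvw; rewrite /ucycle /= !inE /Tvec /cell_lt.
rewrite !cell_eqE -!val_eqE /=.
case: u v w {cuv cvw} => [[a ha] [b hb]] [[a' ha'] [b' hb']].
by case=> [[a'' ha''] [b'' hb'']] /=; do !case: ifP => ?; lia.
Qed.

(** * The lower bound *)

(** Cells that are not late are determined by their columns, late cells by
    their rows. *)
Lemma card_cell_color_class k (T : eqType) (c : cell k -> T) (t : T) :
  no_interleaving c -> #|[set u | c u == t]| <= (k.*2.-1).*2.
Proof.
move=> ok; set S := [set u | _].
pose late : {set cell k} :=
  [set u : cell k | [exists v in S, (v.2 == u.2) && (v.1 < u.1)]].
have lateP i j : (i, j) \in S :&: late ->
    c (i, j) = t /\ exists2 a : 'I_(k.*2.-1), c (a, j) = t & a < i.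
  rewrite !inE /= => /andP[/eqP cj /existsP[[a b] /=]].
  by rewrite inE => /and3P[/eqP ca /eqP eb lt_a]; subst b; split=> //; exists a.
have late_row i j j' :
    (i, j) \in S :&: late -> (i, j') \in S :&: late -> j' <= j.
  move=> /lateP[cj _] /lateP[cj' [a ca lt_a]]; rewrite leqNgt; apply/negP => lt_j.
  have /= := ok (a, j') (i, j) (i, j').
  rewrite ca cj cj' /cell_lt /= lt_a eqxx lt_j orbT => h.
  by move: lt_j; rewrite h // ltnn.
rewrite -(cardsID late S) -addnn.
apply: leq_add; rewrite -[leqRHS]card_ord.
- rewrite -(card_in_imset (f := fst)) ?max_card // => -[i j] [i' j'] /=.
  move=> lj lj' ii'; subst i'; congr (_, _); apply/val_inj/eqP => /=.
  by rewrite eqn_leq (late_row i j' j) // (late_row i j j').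
- rewrite -(card_in_imset (f := snd)) ?max_card // => -[i j] [i' j'].
  rewrite !inE /= => /andP[/existsPn nl cj] /andP[/existsPn nl' cj'] jj'.
  subst j'; congr (_, _); apply: val_inj => /=.
  have := nl (i', j); have := nl' (i, j).
  rewrite !inE cj cj' eqxx /= -!leqNgt => h h'.
  by apply/eqP; rewrite eqn_leq h'.
Qed.

Lemma dicolorable_Tvec_geq k m : dicolorable (@Tvec k) m -> k <= m.
Proof.
move=> [c /dicoloring_no_interleaving ok].
have : #|cell k| <= m * (k.*2.-1).*2.
  rewrite -sum1_card (partition_big c xpredT) //= -[m in leqRHS]card_ord.
  rewrite -sum_nat_const; apply: leq_sum => t _.
  by rewrite sum1dep_card; apply: card_cell_color_class.
by rewrite card_prod card_ord; nia.
Qed.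

(** * The upper bound *)

(** The residue of [u.2 - u.1] modulo [2k], written without division. *)
Definition diagonal k (u : cell k) : nat :=
  if u.1 <= u.2 then u.2 - u.1 else u.2 + k.*2 - u.1.

Lemma diagonal_half_lt k (u : cell k) : (diagonal u)./2 < k.
Proof. by case: u => [[i hi] [j hj]]; rewrite /diagonal /=; case: ifP; lia. Qed.

Definition diagonal_color k (u : cell k) : 'I_k := Ordinal (diagonal_half_lt u).

Lemma diagonal_color_no_interleaving k : no_interleaving (@diagonal_color k).
Proof.
move=> [[a ha] [b hb]] [[a' ha'] [b' hb']] [[a'' ha''] [b'' hb'']].
rewrite /diagonal_color /diagonal /cell_lt -!val_eqE /= => -[+] [].
by do 3!case: ifP => ?; lia.
Qed.

Theorem theorem2p9 (k : nat) (k_gt0 : 0 < k) :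
  is_dichromatic_number (@Tvec k) k.
Proof.
split; last by move=> m; apply: dicolorable_Tvec_geq.
exists (@diagonal_color k).
exact: no_interleaving_dicoloring (@diagonal_color_no_interleaving k).
Qed.
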